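(* Let $\mathcal{E}$ be a globally generated vector bundle of rank $2$ on $Q$ with $c_1(\mathcal{E})=(2,2)$ which does not split. If $(0,2)$ is an index of $\mathcal{E}$, then $\mathcal{E}$ arises in an extension $$0\to\mathcal{O}_Q(0,2)\to\mathcal{E}\to\mathcal{O}_Q(2,0)\to 0.$$ Similarly, if $(2,0)$ is an index of $\mathcal{E}$, then $\mathcal{E}$ arises in an extension $0\to\mathcal{O}_Q(2,0)\to\mathcal{E}\to\mathcal{O}_Q(0,2)\to 0$.
   Context: The base field is $\mathbb{C}$. $Q\cong\mathbb{P}^1\times\mathbb{P}^1$ is a smooth quadric surface, with projections $f,g$ to the two factors, $\mathcal{O}_Q(a,b)=f^*\mathcal{O}_{\mathbb{P}^1}(a)\otimes g^*\mathcal{O}_{\mathbb{P}^1}(b)$ and $\mathcal{E}(a,b)=\mathcal{E}\otimes\mathcal{O}_Q(a,b)$. A vector bundle $\mathcal{E}$ has $c_1(\mathcal{E})=(a,b)\in\mathbb{Z}^{2}$ if $\det\mathcal{E}\cong\mathcal{O}_Q(a,b)$. A bundle splits if it is a direct sum of line bundles. Order $\mathbb{Z}^2$ by $(a',b')\ge(a,b)$ iff $a'\ge a$ and $b'\ge b$; an index of a vector bundle $\mathcal{E}$ is a maximal element, for this order, of $\{(a,b)\in\mathbb{Z}^2 : h^0(\mathcal{E}(-a,-b))\neq 0\}$. *)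

(* Defs.v *)
(* Vector bundles on the quadric P^1 x P^1 over an algebraically closed field
   K, in the language of classical varieties: points, Zariski open sets, regular
   functions.  A vector bundle is given by transition functions relative to an
   arbitrary Zariski open cover, and its sheaf of sections over U consists of
   the compatible families of regular vectors on U. *)
From HB Require Import structures.
From mathcomp Require Import all_boot all_order all_algebra.
From mathcomp Require Import boolp classical_sets reals complex.
From mathcomp Require Import zify ring.

Set Implicit Arguments.
Unset Strict Implicit.
Unset Printing Implicit Defensive.

Import GRing.Theory.
Local Open Scope classical_set_scope.
Local Open Scope ring_scope.

#[local] Obligation Tactic := idtac.

Section Quadric.
Variable K : closedFieldType.

(* The projective line as the set of lines through the origin of K^2. *)
Definition P1 := {L : {vspace 'rV[K]_2} | \dim L == 1%N}.
Definition quadric := (P1 * P1)%type.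

Definition proj (c : bool) (p : quadric) : P1 := if c then p.2 else p.1.

(* A choice of homogeneous coordinates; only quotients of forms of equal
   bidegree, and the vanishing of forms, are used below, and these do not
   depend on it. *)
Definition hcoord (x : P1) (i : 'I_2) : K := vpick (val x) 0 i.

Lemma hcoord_neq0 (x : P1) : exists i, hcoord x i != 0.
Proof.
case: (pickP (fun i => hcoord x i != 0)) => [i Hi|H]; first by exists i.
have : vpick (val x) == 0.
  apply/eqP/rowP => i; rewrite mxE.
  by move/negbFE: (H i) => /eqP.
rewrite vpick0 => /eqP x0; have := valP x.
by rewrite x0 dimv0.
Qed.

(* Bihomogeneous forms of bidegree (a, b): F i j is the coefficient of
   x0^(a-i) x1^i y0^(b-j) y1^j. *)
Definition form (a b : nat) := 'M[K]_(a.+1, b.+1).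

Definition mono (a b : nat) (p : quadric) (i j : nat) : K :=
  hcoord p.1 0 ^+ (a - i) * hcoord p.1 1 ^+ i
  * (hcoord p.2 0 ^+ (b - j) * hcoord p.2 1 ^+ j).

Definition form_eval (a b : nat) (F : form a b) (p : quadric) : K :=
  \sum_(i < a.+1) \sum_(j < b.+1) F i j * mono a b p i j.

Lemma form_evalD a b (F G : form a b) p :
  form_eval (F + G) p = form_eval F p + form_eval G p.
Proof.
rewrite /form_eval -big_split; apply: eq_bigr => i _.
by rewrite -big_split; apply: eq_bigr => j _; rewrite mxE mulrDl.
Qed.

Lemma form_mul a b a' b' (F : form a b) (G : form a' b') :
  exists H : form (a + a') (b + b'),
    forall p, form_eval H p = form_eval F p * form_eval G p.
Proof.
pose cond (s : 'I_(a + a').+1 * 'I_(b + b').+1) (q : 'I_a.+1 * 'I_b.+1)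
    (r : 'I_a'.+1 * 'I_b'.+1) :=
  (q.1 + r.1 == s.1)%N && (q.2 + r.2 == s.2)%N.
exists (\matrix_(i, j) \sum_q \sum_r
   (if cond (i, j) q r then F q.1 q.2 * G r.1 r.2 else 0)) => p.
rewrite /form_eval !pair_bigA /= mulr_suml.
under eq_bigr => s _ do rewrite mxE mulr_suml.
rewrite exchange_big /=; apply: eq_bigr => q _.
rewrite mulr_sumr.
under eq_bigr => s _ do rewrite mulr_suml.
rewrite exchange_big /=; apply: eq_bigr => r _.
have l1 : (q.1 + r.1 < (a + a').+1)%N.
  by rewrite ltnS leq_add // -ltnS ltn_ord.
have l2 : (q.2 + r.2 < (b + b').+1)%N.
  by rewrite ltnS leq_add // -ltnS ltn_ord.
rewrite (bigD1 (Ordinal l1, Ordinal l2)) //= /cond /= !eqxx /= big1 ?addr0.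
  have e m n (i : 'I_m.+1) (j : 'I_n.+1) :
      (m + n - (i + j) = (m - i) + (n - j))%N.
    by have := ltn_ord i; have := ltn_ord j; lia.
  rewrite /mono (e a a' q.1 r.1) (e b b' q.2 r.2) !exprD.
  by ring.
move=> [s1 s2] /= ns; case: ifP => [/andP[/eqP h1 /eqP h2]|]; last by rewrite mul0r.
by case/eqP: ns; congr (_, _); apply: val_inj.
Qed.

(* The Zariski topology: the sets form_eval h p != 0 form a basis. *)
Definition zopen (U : set quadric) :=
  forall p, U p -> exists a b (h : form a b),
    form_eval h p != 0 /\ (forall q, form_eval h q != 0 -> U q).

Definition regular_on (U : set quadric) (f : quadric -> K) :=
  forall p, U p -> exists V, [/\ zopen V, V p, V `<=` U &
    exists a b (g h : form a b), forall q, V q ->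
      form_eval h q != 0 /\ f q = form_eval g q / form_eval h q].

Lemma zopenI U V : zopen U -> zopen V -> zopen (U `&` V).
Proof.
move=> oU oV p [Up Vp].
have [a [b [h [hp hU]]]] := oU p Up; have [a' [b' [h' [hp' hV]]]] := oV p Vp.
have [H HE] := form_mul h h'; exists _, _, H; split.
  by rewrite HE mulf_neq0.
by move=> q; rewrite HE mulf_eq0 negb_or => /andP[? ?]; split; [apply: hU|apply: hV].
Qed.

Lemma form_cst (c : K) : exists h : form 0 0, forall p, form_eval h p = c.
Proof.
exists (const_mx c) => p.
by rewrite /form_eval !big_ord1 mxE /mono !subnn !expr0 !mulr1.
Qed.

Lemma zopenT : zopen setT.
Proof.
move=> p _; have [h hE] := form_cst 1; exists _, _, h; split => //.
by rewrite hE oner_neq0.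
Qed.

Lemma zopen_forall (n : nat) (U : 'I_n -> set quadric) :
  (forall i, zopen (U i)) -> zopen [set p | forall i, U i p].
Proof.
elim: n U => [|n IH] U oU.
  suff -> : [set p | forall i, U i p] = setT by exact: zopenT.
  by apply/seteqP; split => // p _ [].
suff -> : [set p | forall i, U i p]
    = U ord0 `&` [set p | forall i, U (lift ord0 i) p].
  by apply: zopenI => //; apply: IH.
apply/seteqP; split => [p Up|p [U0 Up] i]; first by split.
by case: (unliftP ord0 i) => [j|] ->.
Qed.

Lemma regular_onS U V f :
  zopen V -> V `<=` U -> regular_on U f -> regular_on V f.
Proof.
move=> oV VU rf p Vp.
have [W [oW Wp WU [a [b [g [h gh]]]]]] := rf p (VU p Vp).
exists (W `&` V); split; [exact: zopenI|by split|by move=> q []|].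
by exists a, b, g, h => q [/gh].
Qed.

Lemma eq_regular_on U f g :
  (forall p, U p -> f p = g p) -> regular_on U f -> regular_on U g.
Proof.
move=> fg rf p Up; have [W [oW Wp WU [a [b [u [v uv]]]]]] := rf p Up.
exists W; split => //; exists a, b, u, v => q Wq.
by have [? <-] := uv q Wq; rewrite fg //; apply: WU.
Qed.

Lemma regular_on_cst U c : zopen U -> regular_on U (fun=> c).
Proof.
move=> oU p Up; exists U; split => //.
have [g gE] := form_cst c; have [h hE] := form_cst 1.
by exists _, _, g, h => q _; rewrite gE hE divr1 oner_neq0.
Qed.

Lemma regular_onM U f g :
  regular_on U f -> regular_on U g -> regular_on U (fun p => f p * g p).
Proof.
move=> rf rg p Up.
have [V [oV Vp VU [a [b [u [v uv]]]]]] := rf p Up.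
have [W [oW Wp _ [a' [b' [u' [v' uv']]]]]] := rg p Up.
exists (V `&` W); split; [exact: zopenI|by []|by move=> q [/VU]|].
have [N NE] := form_mul u u'; have [D DE] := form_mul v v'.
exists _, _, N, D => q [/uv[v0 ->] /uv'[v'0 ->]].
by rewrite NE DE mulf_neq0 // mulf_div.
Qed.

Lemma regular_onD U f g :
  regular_on U f -> regular_on U g -> regular_on U (fun p => f p + g p).
Proof.
move=> rf rg p Up.
have [V [oV Vp VU [a [b [u [v uv]]]]]] := rf p Up.
have [W [oW Wp _ [a' [b' [u' [v' uv']]]]]] := rg p Up.
exists (V `&` W); split; [exact: zopenI|by []|by move=> q [/VU]|].
have [N NE] := form_mul u v'; have [N' NE'] := form_mul v u'.
have [D DE] := form_mul v v'.
exists _, _, (N + N'), D => q [/uv[v0 ->] /uv'[v'0 ->]].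
by rewrite form_evalD NE NE' DE mulf_neq0 // addf_div // (mulrC (form_eval u' q)).
Qed.

Lemma regular_on_sum U (I : Type) (r : seq I) (f : I -> quadric -> K) :
  zopen U -> (forall i, regular_on U (f i)) ->
  regular_on U (fun p => \sum_(i <- r) f i p).
Proof.
move=> oU rf; elim: r => [|i r IH].
  by apply: eq_regular_on (regular_on_cst 0 oU) => p _; rewrite big_nil.
by apply: eq_regular_on (regular_onD (rf i) IH) => p _; rewrite big_cons.
Qed.

Lemma regular_on_prod U (I : Type) (r : seq I) (f : I -> quadric -> K) :
  zopen U -> (forall i, regular_on U (f i)) ->
  regular_on U (fun p => \prod_(i <- r) f i p).
Proof.
move=> oU rf; elim: r => [|i r IH].
  by apply: eq_regular_on (regular_on_cst 1 oU) => p _; rewrite big_nil.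
by apply: eq_regular_on (regular_onM (rf i) IH) => p _; rewrite big_cons.
Qed.

Lemma regular_on_det U r (A : quadric -> 'M[K]_r) :
  zopen U -> (forall i j, regular_on U (fun p => A p i j)) ->
  regular_on U (fun p => \det (A p)).
Proof.
move=> oU rA; apply: regular_on_sum => // s; apply: regular_onM.
  exact: regular_on_cst.
by apply: regular_on_prod => // i.
Qed.

Definition std_chart (c : bool) (i : 'I_2) : set quadric :=
  [set p | hcoord (proj c p) i != 0].

Lemma form_hcoord (c : bool) (i : 'I_2) : exists h : form (~~ c) c,
  forall p, form_eval h p = hcoord (proj c p) i.
Proof.
case: c => /=.
  exists (\matrix_(k, l) (l == i)%:R) => p.
  rewrite /form_eval big_ord1 (bigD1 i) //= big1 => [|j ji]; last first.
    by rewrite mxE (negPf ji) mul0r.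
  rewrite mxE eqxx /mono !expr0 addr0 !mul1r /proj.
  have [-> | ->] : i = 0 \/ i = 1 by case: i => [[|[|]]] // ?; [left|right]; apply: val_inj.
    by rewrite expr1 mulr1.
  by rewrite expr1 mul1r.
exists (\matrix_(k, l) (k == i)%:R) => p.
rewrite /form_eval (bigD1 i) //= [X in _ + X]big1 => [|j ji]; last first.
  by rewrite big_ord1 mxE (negPf ji) mul0r.
rewrite big_ord1 mxE eqxx /mono !expr0 addr0 !mulr1 mul1r /proj.
have [-> | ->] : i = 0 \/ i = 1 by case: i => [[|[|]]] // ?; [left|right]; apply: val_inj.
  by rewrite expr1 mulr1.
by rewrite expr1 mul1r.
Qed.

Lemma zopen_std_chart c i : zopen (std_chart c i).
Proof.
move=> p pi; have [h hE] := form_hcoord c i; exists _, _, h.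
by split=> [|q]; rewrite hE.
Qed.

Arguments zopen_std_chart c i : clear implicits.

Lemma regular_on_ratio c (i j : 'I_2) (n : int) :
  regular_on (std_chart c i `&` std_chart c j)
    (fun p => (hcoord (proj c p) j / hcoord (proj c p) i) ^ n).
Proof.
have oU := zopenI (zopen_std_chart c i) (zopen_std_chart c j).
have r1 k l : regular_on (std_chart c k `&` std_chart c l)
    (fun p => hcoord (proj c p) l / hcoord (proj c p) k).
  move=> p pi; exists (std_chart c k `&` std_chart c l); split => //.
    exact: zopenI (zopen_std_chart c k) (zopen_std_chart c l).
  have [g gE] := form_hcoord c l; have [h hE] := form_hcoord c k.
  by exists _, _, g, h => q [q0 _]; rewrite gE hE.
have rX k l m : regular_on (std_chart c k `&` std_chart c l)
    (fun p => (hcoord (proj c p) l / hcoord (proj c p) k) ^+ m).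
  have oW := zopenI (zopen_std_chart c k) (zopen_std_chart c l).
  elim: m => [|m IH]; first by apply: eq_regular_on (regular_on_cst 1 oW).
  by apply: eq_regular_on (regular_onM (r1 k l) IH) => p _; rewrite exprS.
case: n => n; first exact: rX.
rewrite setIC; apply: eq_regular_on (rX j i n.+1) => p _.
by rewrite NegzE -exprnN -exprVn invf_div.
Qed.

Arguments regular_on_ratio c i j n : clear implicits.

(* A rank r bundle is glued from the trivial bundles on the sets chart i; a
   vector v over p in chart j is identified with trans i j p *m v in chart i. *)
Record bundle (r : nat) := Bundle {
  index : Type;
  chart : index -> set quadric;
  trans : index -> index -> quadric -> 'M[K]_r;
  zopen_chart : forall i, zopen (chart i);
  chart_cover : forall p, exists i, chart i p;
  regular_trans : forall i j k l,
    regular_on (chart i `&` chart j) (fun p => trans i j p k l);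
  trans_id : forall i p, chart i p -> trans i i p = 1%:M;
  trans_cocycle : forall i j k p, chart i p -> chart j p -> chart k p ->
    trans i j p *m trans j k p = trans i k p
}.
Arguments trans {r} b i j p.
Arguments chart {r} b i p.
Arguments zopen_chart {r} b i.
Arguments chart_cover {r} b p.
Arguments regular_trans {r} b i j k l.
Arguments trans_id {r b i p}.
Arguments trans_cocycle {r b i j k p}.

(* c = false: f^* O_{P^1}(n); c = true: g^* O_{P^1}(n).  The local functions
   of a form F of degree n are F / x_i^n, whence the transition functions. *)
Program Definition pullback_O (c : bool) (n : int) : bundle 1 :=
  @Bundle 1 'I_2 (std_chart c)
    (fun i j p => ((hcoord (proj c p) j / hcoord (proj c p) i) ^ n)%:M)
    (zopen_std_chart c) _ _ _ _.
Next Obligation. by move=> c n p; apply: hcoord_neq0. Qed.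
Next Obligation.
move=> c n i j k l; apply: eq_regular_on (regular_on_ratio c i j n) => p _.
by rewrite mxE !ord1 eqxx mulr1n.
Qed.
Next Obligation. by move=> c n i p pi; rewrite /= divff // exp1rz. Qed.
Next Obligation.
move=> c n i j k p pi pj pk /=; rewrite -scalar_mxM -exprzMl; last 2 first.
- by rewrite unitfE mulf_neq0 ?invr_neq0.
- by rewrite unitfE mulf_neq0 ?invr_neq0.
by congr ((_ ^ _)%:M); rewrite mulrC mulrA divfK.
Qed.

(* E (x) L for a line bundle L: the Kronecker product with a 1 x 1 matrix. *)
Program Definition tensor_line (r : nat) (E : bundle r) (L : bundle 1) :
    bundle r :=
  @Bundle r (index E * index L)%type
    (fun i => chart E i.1 `&` chart L i.2)
    (fun i j p => trans L i.2 j.2 p 0 0 *: trans E i.1 j.1 p) _ _ _ _ _.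
Next Obligation. by move=> r E L i; apply: zopenI; apply: zopen_chart. Qed.
Next Obligation.
move=> r E L p; have [i pi] := chart_cover E p.
by have [j pj] := chart_cover L p; exists (i, j).
Qed.
Next Obligation.
move=> r E L i j k l;
apply: (@eq_regular_on _ (fun p => trans L i.2 j.2 p 0 0 * trans E i.1 j.1 p k l)).
  by move=> p _; rewrite mxE.
apply: regular_onM.
  apply: regular_onS (regular_trans L i.2 j.2 0 0); first by apply: zopenI; apply: zopenI; apply: zopen_chart.
  by move=> p [[? ?] [? ?]].
apply: regular_onS (regular_trans E i.1 j.1 k l); first by apply: zopenI; apply: zopenI; apply: zopen_chart.
by move=> p [[? ?] [? ?]].
Qed.
Next Obligation.
by move=> r E L i p [pi pi']; rewrite !trans_id // mxE eqxx scale1r.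
Qed.
Next Obligation.
move=> r E L i j k p [pi pi'] [pj pj'] [pk pk'] /=.
rewrite -scalemxAl -scalemxAr scalerA trans_cocycle //.
by rewrite -(trans_cocycle pi' pj' pk') mxE big_ord1.
Qed.

Definition OQ (a b : int) : bundle 1 :=
  tensor_line (pullback_O false a) (pullback_O true b).

Definition twist (r : nat) (E : bundle r) (a b : int) : bundle r :=
  tensor_line E (OQ a b).

Program Definition det_bundle (r : nat) (E : bundle r) : bundle 1 :=
  @Bundle 1 (index E) (chart E) (fun i j p => (\det (trans E i j p))%:M)
    (zopen_chart E) (chart_cover E) _ _ _.
Next Obligation.
move=> r E i j k l.
apply: (@eq_regular_on _ (fun p => \det (trans E i j p))).
  by move=> p _; rewrite mxE !ord1 eqxx mulr1n.
apply: regular_on_det; first by apply: zopenI; apply: zopen_chart.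
exact: regular_trans.
Qed.
Next Obligation. by move=> r E i p pi /=; rewrite trans_id // det1. Qed.
Next Obligation.
by move=> r E i j k p pi pj pk /=; rewrite -scalar_mxM -det_mulmx trans_cocycle.
Qed.

Program Definition sum_lines (r : nat) (L : 'I_r -> bundle 1) : bundle r :=
  @Bundle r (forall k, index (L k))
    (fun i => [set p | forall k, chart (L k) (i k) p])
    (fun i j p => diag_mx (\row_k trans (L k) (i k) (j k) p 0 0)) _ _ _ _ _.
Next Obligation. by move=> r L i; apply: zopen_forall => k; apply: zopen_chart. Qed.
Next Obligation.
move=> r L p; pose P k := cid (chart_cover (L k) p).
by exists (fun k => projT1 (P k)) => k; apply: projT2 (P k).
Qed.
Next Obligation.
move=> r L i j k l.
have oU : zopen ([set p | forall k, chart (L k) (i k) p]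
                 `&` [set p | forall k, chart (L k) (j k) p]).
  by apply: zopenI; apply: zopen_forall => m; apply: zopen_chart.
have [<-|kl] := eqVneq k l; last first.
  apply: eq_regular_on (regular_on_cst 0 oU) => p _.
  by rewrite !mxE (negPf kl) mulr0n.
apply: (@eq_regular_on _ (fun p => trans (L k) (i k) (j k) p 0 0)).
  by move=> p _; rewrite !mxE eqxx mulr1n.
apply: regular_onS oU _ (regular_trans (L k) (i k) (j k) 0 0).
by move=> p [pi pj]; split; [apply: pi|apply: pj].
Qed.
Next Obligation.
move=> r L i p pi /=; apply/matrixP => k l; rewrite !mxE.
by rewrite (trans_id (pi k)) mxE eqxx.
Qed.
Next Obligation.
move=> r L i j k p pi pj pk /=; rewrite mulmx_diag; congr diag_mx.
apply/rowP => m; rewrite !mxE -(trans_cocycle (pi m) (pj m) (pk m)).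
by rewrite mxE big_ord1.
Qed.

(* Families of vectors, one in each chart.  Two families represent the same
   section over U when they agree over U, i.e. values outside U or outside the
   chart are irrelevant. *)
Definition family (r : nat) (E : bundle r) := index E -> quadric -> 'cV[K]_r.

Definition is_section (r : nat) (E : bundle r) (U : set quadric)
    (s : family E) :=
  (forall i k, regular_on (U `&` chart E i) (fun p => s i p k 0)) /\
  (forall i j p, U p -> chart E i p -> chart E j p ->
     s i p = trans E i j p *m s j p).

Definition eq_on (r : nat) (E : bundle r) (U : set quadric) (s t : family E) :=
  forall i p, U p -> chart E i p -> s i p = t i p.

Definition zero_section (r : nat) (E : bundle r) : family E := fun _ _ => 0.

Arguments zero_section {r} E.

Definition h0_neq0 (r : nat) (E : bundle r) :=
  exists s : family E, is_section setT s /\ ~ eq_on setT s (zero_section E).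

(* The global sections generate the sheaf of sections as an O_Q-module. *)
Definition globally_generated (r : nat) (E : bundle r) :=
  forall (U : set quadric) (t : family E), zopen U -> is_section U t ->
  forall p, U p -> exists V, [/\ zopen V, V p, V `<=` U &
    exists (n : nat) (s : 'I_n -> family E) (f : 'I_n -> quadric -> K),
      [/\ forall k, is_section setT (s k), forall k, regular_on V (f k) &
          eq_on V t (fun i q => \sum_k f k q *: s k i q)]].

Record morphism (r r' : nat) (E : bundle r) (F : bundle r') := Morphism {
  mor : index F -> index E -> quadric -> 'M[K]_(r', r);
  regular_mor : forall k i m n,
    regular_on (chart F k `&` chart E i) (fun p => mor k i p m n);
  mor_compat : forall k l i j p, chart F k p -> chart F l p ->
    chart E i p -> chart E j p ->
    trans F l k p *m mor k i p *m trans E i j p = mor l j p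
}.

Arguments mor {r r' E F} _ k i p.

(* On U, the section t of F is the image of the section s of E. *)
Definition maps_to (r r' : nat) (E : bundle r) (F : bundle r')
    (phi : morphism E F) (U : set quadric) (s : family E) (t : family F) :=
  forall k i p, U p -> chart F k p -> chart E i p ->
    mor phi k i p *m s i p = t k p.

Definition isomorphic (r r' : nat) (E : bundle r) (F : bundle r') :=
  exists (phi : morphism E F) (psi : morphism F E),
    forall i k p, chart E i p -> chart F k p ->
      mor psi i k p *m mor phi k i p = 1%:M /\
      mor phi k i p *m mor psi i k p = 1%:M.

Definition splits (r : nat) (E : bundle r) :=
  exists L : 'I_r -> bundle 1, isomorphic E (sum_lines L).

Definition has_c1 (r : nat) (E : bundle r) (a b : int) :=
  isomorphic (det_bundle E) (OQ a b).

Definition is_index (r : nat) (E : bundle r) (a b : int) :=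
  h0_neq0 (twist E (- a) (- b)) /\
  forall a' b' : int, h0_neq0 (twist E (- a') (- b')) ->
    (a <= a')%R -> (b <= b')%R -> a' = a /\ b' = b.

(* Exactness of 0 -> E' -> E -> E'' -> 0 as a sequence of sheaves of sections. *)
Definition short_exact (r' r r'' : nat) (E' : bundle r') (E : bundle r)
    (E'' : bundle r'') (phi : morphism E' E) (psi : morphism E E'') :=
  [/\ forall U s, zopen U -> is_section U s ->
        maps_to phi U s (zero_section E) -> eq_on U s (zero_section E'),
      forall U s t, zopen U -> is_section U s -> is_section U t ->
        maps_to phi U s t -> maps_to psi U t (zero_section E''),
      forall U t, zopen U -> is_section U t ->
        maps_to psi U t (zero_section E'') ->
        forall p, U p -> exists V s,
          [/\ zopen V, V p, V `<=` U, is_section V s & maps_to phi V s t] &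
      forall U m, zopen U -> is_section U m ->
        forall p, U p -> exists V t,
          [/\ zopen V, V p, V `<=` U, is_section V t & maps_to psi V t m]].

Definition extension (r' r r'' : nat) (E' : bundle r') (E : bundle r)
    (E'' : bundle r'') :=
  exists (phi : morphism E' E) (psi : morphism E E''), short_exact phi psi.

End Quadric.

(* Main.v *)
Require Import Defs.
From mathcomp Require Import all_boot all_order all_algebra.
From mathcomp Require Import boolp classical_sets reals complex.
From mathcomp Require Import zify ring.

(** Let m = (0, 2) be the index (the case (2, 0) is symmetric), and let s be a
    nonzero section of E(-m).  Since det E = O(2, 2), contraction with s,
    t |-> s /\ t, is a morphism from E to O(2, 0), and it kills s: everything
    follows once s is known to vanish nowhere, because the resulting sequence
    0 -> O(m) -> E -> O(2, 0) -> 0 is then exact at every point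
    ([nowhere_zero_extension]).

    Suppose s vanishes at p, and let F be the fibre through p of the first
    projection.  For a global section t of E, s /\ t is a section of O(2, 0);
    this bundle is trivial on F, and a regular function on a projective line
    is constant ([regular_P1_cst]), so s /\ t, which vanishes at p, vanishes on
    F ([section_fibre_eq0]).  Hence at a point of F where s is nonzero all
    global sections of E would lie on the line spanned by s, against global
    generation: s vanishes on all of F ([vanishing_on_fibre]).  Then s can be
    divided by the equation of F ([regular_on_dvd], [twist_divide]), which
    gives a nonzero section of E(-1, -2) and contradicts the maximality of m.

    The argument only uses that the second weight m' = c1(E) - m vanishes in
    the direction of F, so it is carried out for arbitrary weights m and m'
    with that property ([index_extension]).  Both halves of the theorem are
    instances: the factor of the quadric on which the fibre lies is a boolean
    parameter c throughout, a fibre being the locus where [proj c] is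
    constant. *)

Set Implicit Arguments.
Unset Strict Implicit.
Unset Printing Implicit Defensive.

Import GRing.Theory.
Local Open Scope classical_set_scope.
Local Open Scope ring_scope.

(** * Bihomogeneous forms as functions on the quadric *)

Lemma ord2P (P : 'I_2 -> Prop) : P 0 -> P 1 -> forall i, P i.
Proof.
move=> P0 P1 [[|[|//]] i2].
  by have -> : Ordinal i2 = 0 by exact: val_inj.
by have -> : Ordinal i2 = 1 by exact: val_inj.
Qed.

Lemma matrix_neq0 (R : nzRingType) m n (A : 'M[R]_(m, n)) :
  A != 0 -> exists i j, A i j != 0.
Proof.
move=> A0; apply: contrapT => nA; case/eqP: A0; apply/matrixP => i j.
by rewrite mxE; apply: contrapT => /eqP Aij; apply: nA; exists i, j.
Qed.

Section Forms.
Variable K : closedFieldType.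
Implicit Types (c : bool) (x y z P : P1 K) (p q : quadric K) (d e : bool -> nat).

(** Forms are handled through the function they induce on the quadric, which
    frees products from casts between matrix sizes.  The bidegree is indexed
    by the factor so that the two rulings can be treated at once. *)
Definition bihom d (f : quadric K -> K) :=
  exists F : Defs.form K (d false) (d true), forall p, form_eval F p = f p.

Definition bideg c (a b : nat) : bool -> nat := fun c0 => if c0 == c then a else b.

Lemma bihom_ext d e f : (forall c, d c = e c) -> bihom d f -> bihom e f.
Proof. by rewrite /bihom => de [F Ff]; rewrite -!de; exists F. Qed.

Lemma eq_bihom d f g : f =1 g -> bihom d f -> bihom d g.
Proof. by move=> fg [F Ff]; exists F => p; rewrite Ff fg. Qed.

Lemma bihomM d e f g : bihom d f -> bihom e g ->
  bihom (fun c => d c + e c)%N (fun p => f p * g p).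
Proof.
by move=> [F Ff] [G Gg]; have [H HE] := form_mul F G; exists H => p; rewrite HE Ff Gg.
Qed.

Lemma bihomD d f g : bihom d f -> bihom d g -> bihom d (fun p => f p + g p).
Proof.
by move=> [F Ff] [G Gg]; exists (F + G) => p; rewrite form_evalD Ff Gg.
Qed.

Lemma bihom0 d : bihom d (fun=> 0).
Proof.
exists 0 => p; rewrite /form_eval big1 // => i _; rewrite big1 // => j _.
by rewrite mxE mul0r.
Qed.

Lemma bihom_cst (k : K) : bihom (fun=> 0%N) (fun=> k).
Proof. by have [h hE] := form_cst k; exists h. Qed.

Lemma bihomZ d (k : K) f : bihom d f -> bihom d (fun p => k * f p).
Proof. by move=> /(bihomM (bihom_cst k)). Qed.

Lemma bihomB d f g : bihom d f -> bihom d g -> bihom d (fun p => f p - g p).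
Proof.
move=> bf /(bihomZ (-1)) /(bihomD bf); apply: eq_bihom => p.
by rewrite mulN1r.
Qed.

Lemma bihom_sum d (I : Type) (r : seq I) (f : I -> quadric K -> K) :
  (forall i, bihom d (f i)) -> bihom d (fun p => \sum_(i <- r) f i p).
Proof.
move=> bf; elim: r => [|i r IH].
  by apply: eq_bihom (bihom0 d) => p; rewrite big_nil.
by apply: eq_bihom (bihomD (bf i) IH) => p; rewrite big_cons.
Qed.

Lemma bihom_coord c i : bihom (bideg c 1 0) (fun p => hcoord (proj c p) i).
Proof.
have [h hE] := form_hcoord K c i.
by case: c h hE => h hE; exists h.
Qed.

Lemma bihomX d f n : bihom d f -> bihom (fun c => n * d c)%N (fun p => f p ^+ n).
Proof.
move=> bf; elim: n => [|n IH]; first exact: bihom_cst.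
by apply: eq_bihom (bihom_ext _ (bihomM bf IH)) => [p|c]; rewrite ?exprS // mulSn.
Qed.

Lemma bihom_coordX c i n :
  bihom (bideg c n 0) (fun p => hcoord (proj c p) i ^+ n).
Proof.
apply: bihom_ext (bihomX n (bihom_coord c i)) => e.
by rewrite /bideg; case: eqP; rewrite ?muln1 ?muln0.
Qed.

(** A form in one set of variables is a form on the quadric that is constant in
    the other factor, so the closure properties above apply to it. *)
Definition homog c (b : nat) (u : P1 K -> K) :=
  bihom (bideg c b 0) (fun p => u (proj c p)).

(** Reading a form as a polynomial in the variables of one factor, with
    coefficients that are forms in the variables of the other one. *)
Lemma bihom_expand c d f : bihom d f ->
  exists u : nat -> P1 K -> K, (forall k, homog (~~ c) (d (~~ c)) (u k)) /\
  forall p, f p = \sum_(k < (d c).+1) hcoord (proj c p) 0 ^+ (d c - k) *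
     hcoord (proj c p) 1 ^+ k * u k (proj (~~ c) p).
Proof.
have hom (e : bool) b (v : nat -> K) : homog e b (fun y => \sum_(j < b.+1)
    v j * (hcoord y 0 ^+ (b - j) * hcoord y 1 ^+ j)).
  apply: bihom_sum => j; apply: bihomZ.
  apply: bihom_ext (bihomM (bihom_coordX e 0 (b - j)) (bihom_coordX e 1 j)) => a.
  by rewrite /bideg; have := ltn_ord j; case: eqP; lia.
move=> [F Ff]; case: c => /=.
  exists (fun k y => \sum_(j < (d false).+1) F (inord j) (inord k) *
       (hcoord y 0 ^+ (d false - j) * hcoord y 1 ^+ j)).
  split=> [k|p]; first exact: (hom false _ (fun j => F (inord j) (inord k))).
  rewrite -Ff /form_eval exchange_big /=; apply: eq_bigr => k _.
  rewrite mulr_sumr; apply: eq_bigr => j _.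
  by rewrite !inord_val /mono /=; ring.
exists (fun k y => \sum_(j < (d true).+1) F (inord k) (inord j) *
     (hcoord y 0 ^+ (d true - j) * hcoord y 1 ^+ j)).
split=> [k|p]; first exact: (hom true _ (fun j => F (inord k) (inord j))).
rewrite -Ff /form_eval /=; apply: eq_bigr => k _.
rewrite mulr_sumr; apply: eq_bigr => j _.
by rewrite !inord_val /mono /=; ring.
Qed.

Definition pt c x y : quadric K := if c then (y, x) else (x, y).

Lemma proj_pt c x y : proj c (pt c x y) = x.
Proof. by case: c. Qed.

Lemma projN_pt c x y : proj (~~ c) (pt c x y) = y.
Proof. by case: c. Qed.

Lemma pt_proj c p : pt c (proj c p) (proj (~~ c) p) = p.
Proof. by case: c p => -[]. Qed.

(** Homogeneous coordinates are chosen once for every point, so a prescribed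
    pair is reached only up to the nonzero factor l. *)
Lemma P1_point (t0 t1 : K) : (t0 != 0) || (t1 != 0) ->
  exists x (l : K), [/\ l != 0, hcoord x 0 = l * t0 & hcoord x 1 = l * t1].
Proof.
move=> t_neq0; pose v : 'rV[K]_2 := \row_i (if i == 0 then t0 else t1).
have v0 : v != 0.
  apply/eqP => /rowP v0; have := v0 0; have := v0 1; rewrite !mxE /= => e1 e0.
  by move: t_neq0; rewrite e0 e1 eqxx.
have L : \dim <[v]> == 1%N by rewrite dim_vline v0.
have /vlineP[l lE] := memv_pick <[v]>.
exists (exist _ <[v]>%VS L), l; rewrite /hcoord /= lE !mxE /=; split=> //.
apply/eqP => l0; have := vpick0 <[v]>%VS.
by rewrite lE l0 scale0r eqxx -dimv_eq0 (eqP L).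
Qed.

Lemma homog_expand c b u : homog c b u -> exists a : nat -> K,
  forall x, u x = \sum_(k < b.+1) hcoord x 0 ^+ (b - k) * hcoord x 1 ^+ k * a k.
Proof.
move=> /(bihom_expand c) [v [_ vE]].
have [|y0 _] := @P1_point 1 0; first by rewrite oner_neq0.
exists (fun k => v k y0) => x; have := vE (pt c x y0).
by rewrite !proj_pt projN_pt /bideg eqxx.
Qed.

Lemma homog_slice c d f x : bihom d f -> homog (~~ c) (d (~~ c)) (fun y => f (pt c x y)).
Proof.
move=> /(bihom_expand c) [u [hu fE]].
have := bihom_sum (index_enum _) (fun k : 'I_(d c).+1 =>
  bihomZ (hcoord x 0 ^+ (d c - k) * hcoord x 1 ^+ k) (hu k)).
by apply: eq_bihom => p; rewrite fE !proj_pt projN_pt.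
Qed.

(** The projective line is irreducible: in an affine coordinate two nonzero
    forms become nonzero polynomials, whose product has a nonroot. *)
Lemma homog_domain c b b' u v x :
  homog c b u -> homog c b' v -> (forall y, u y * v y = 0) -> u x != 0 ->
  forall y, v y = 0.
Proof.
move=> hu hv uv0 ux y; apply/eqP/negPn/negP => vy.
have aff n w z : homog c n w -> w z != 0 -> exists2 A : {poly K}, A != 0 &
    forall t z' l, hcoord z' 0 = l * 1 -> hcoord z' 1 = l * t ->
    w z' = l ^+ n * A.[t].
  move=> /homog_expand[a wE] wz; exists (\poly_(k < n.+1) a k).
    apply: contraNneq wz => A0; rewrite wE big1 // => k _.
    have := congr1 (fun B : {poly K} => B`_k) A0.
    by rewrite coef_poly ltn_ord coef0 => ->; rewrite mulr0.
  move=> t z' l z0 z1; rewrite wE horner_poly mulr_sumr; apply: eq_bigr => k _.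
  have -> : l ^+ n = l ^+ (n - k) * l ^+ k by rewrite -exprD subnK // -ltnS.
  by rewrite z0 z1 mulr1 exprMn; ring.
have [A A0 uE] := aff _ _ _ hu ux; have [B B0 vE] := aff _ _ _ hv vy.
have /closed_nonrootP[t] : A * B != 0 by rewrite mulf_neq0.
rewrite rootM negb_or !rootE => /andP[At Bt].
have [|z [l [l0 z0 z1]]] := @P1_point 1 t; first by rewrite oner_neq0.
have /eqP := uv0 z; rewrite (uE t z l) // (vE t z l) //.
by rewrite !mulf_eq0 !expf_eq0 (negPf l0) !andbF /= (negPf At) (negPf Bt).
Qed.

(** The quadric is irreducible: through points where f and g do not vanish pass
    two horizontal lines, on which f and g are nonzero for generic abscissa;
    for an abscissa good for both, irreducibility of the vertical line
    concludes. *)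
Lemma bihom_domain d e f g p : bihom d f -> bihom e g ->
  (forall q, f q * g q = 0) -> f p != 0 -> forall q, g q = 0.
Proof.
move=> hf hg fg0 fp q; apply/eqP/negPn/negP => gq.
have swap a (h : quadric K -> K) y : bihom a h -> homog false (a false) (fun x => h (pt true y x)).
  exact: (@homog_slice true).
pose u x := f (pt true p.2 x); pose v x := g (pt true q.2 x).
have ux : u p.1 != 0 by rewrite /u /= -surjective_pairing.
have vx : v q.1 != 0 by rewrite /v /= -surjective_pairing.
have [x /andP[ux0 vx0]] : exists x, (u x != 0) && (v x != 0).
  apply: contrapT => /forallNP nex; case/eqP: vx.
  apply: (homog_domain (swap _ _ p.2 hf) (swap _ _ q.2 hg) _ ux) => x.
  have /negP := nex x; rewrite negb_and !negbK => /orP[/eqP|/eqP] xE.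
    by rewrite [f _]xE mul0r.
  by rewrite [g _]xE mulr0.
case/eqP: vx0; apply: (homog_domain (@homog_slice false _ _ x hf)
  (@homog_slice false _ _ x hg) _ ux0) => y; exact: fg0.
Qed.

(** * Divisibility by the equation of a fibre *)

Definition fibre_eqn c P p : K :=
  hcoord (proj c p) 1 * hcoord P 0 - hcoord (proj c p) 0 * hcoord P 1.

Lemma bihom_fibre_eqn c P : bihom (bideg c 1 0) (fibre_eqn c P).
Proof.
apply: bihomB.
  by apply: eq_bihom (bihomZ (hcoord P 0) (bihom_coord c 1)) => p; rewrite mulrC.
by apply: eq_bihom (bihomZ (hcoord P 1) (bihom_coord c 0)) => p; rewrite mulrC.
Qed.

Lemma hcoord_neq0_or x : (hcoord x 0 != 0) || (hcoord x 1 != 0).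
Proof.
have [i iP] := hcoord_neq0 x; move: i iP.
by apply: ord2P => ->; rewrite ?orbT.
Qed.

(** A monomial in x is congruent to its value at P, up to the factors that
    make both sides homogeneous, modulo the equation of P: with i = 0 this is
    the factorization of u^k - v^k for u = P0 x1 and v = x0 P1. *)
Lemma fibre_eqn_dvd_monomial c P n m k i : (m + k)%N = n.+1 -> exists2 r,
  bihom (bideg c n 0) r & forall p,
    hcoord P i ^+ n.+1 * (hcoord (proj c p) 0 ^+ m * hcoord (proj c p) 1 ^+ k)
    - hcoord (proj c p) i ^+ n.+1 * (hcoord P 0 ^+ m * hcoord P 1 ^+ k)
    = fibre_eqn c P p * r p.
Proof.
move=> mk; pose X j p := hcoord (proj c p) j.
have hom a b (j l : 'I_2) (t t' : K) h : (a + b + h)%N = n -> bihom (bideg c n 0)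
    (fun p => X l p ^+ h * ((t * X j p) ^+ a * (X l p * t') ^+ b)).
  move=> abn; have := bihomM (bihom_coordX c l (b + h)) (bihom_coordX c j a).
  move=> /(bihomZ (t ^+ a * t' ^+ b)) hX.
  apply: eq_bihom (bihom_ext _ hX) => [p|c0] /=.
    by rewrite /X !exprMn !exprD; ring.
  by rewrite /bideg; case: eqP; lia.
move: i; apply: ord2P.
  exists (fun p => hcoord P 0 ^+ m * \sum_(j < k) X 0 p ^+ m *
    ((hcoord P 0 * X 1 p) ^+ (k.-1 - j) * (X 0 p * hcoord P 1) ^+ j)).
    apply: bihomZ; apply: bihom_sum => j; apply: hom.
    by have := ltn_ord j; lia.
  move=> p; rewrite -mulr_sumr -mk !exprD.
  transitivity (hcoord P 0 ^+ m * X 0 p ^+ m *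
     ((hcoord P 0 * X 1 p) ^+ k - (X 0 p * hcoord P 1) ^+ k)).
    by rewrite !exprMn /X; ring.
  rewrite subrXX /fibre_eqn -/(X 0 p) -/(X 1 p).
  rewrite (eq_bigr (fun j : 'I_k => (hcoord P 0 * X 1 p) ^+ (k.-1 - j) * (X 0 p * hcoord P 1) ^+ j)).
    by ring.
  by move=> j _; rewrite -subn1 -subnDA add1n.
exists (fun p => - hcoord P 1 ^+ k * \sum_(j < m) X 1 p ^+ k *
    ((hcoord P 1 * X 0 p) ^+ (m.-1 - j) * (X 1 p * hcoord P 0) ^+ j)).
  apply: bihomZ; apply: bihom_sum => j; apply: hom.
  by have := ltn_ord j; lia.
move=> p; rewrite -mulr_sumr -mk !exprD.
transitivity (hcoord P 1 ^+ k * X 1 p ^+ k *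
   ((hcoord P 1 * X 0 p) ^+ m - (X 1 p * hcoord P 0) ^+ m)).
  by rewrite !exprMn /X; ring.
rewrite subrXX /fibre_eqn -/(X 0 p) -/(X 1 p).
rewrite (eq_bigr (fun j : 'I_m => (hcoord P 1 * X 0 p) ^+ (m.-1 - j) * (X 1 p * hcoord P 0) ^+ j)).
  by ring.
by move=> j _; rewrite -subn1 -subnDA add1n.
Qed.

(** Modulo the equation of the fibre over P, the form f is its restriction to
    that fibre, up to a power of a coordinate which is nonzero at P. *)
Lemma fibre_eqn_dvd c P d f n : bihom d f -> d c = n.+1 ->
  (forall p, proj c p = P -> f p = 0) ->
  exists2 g, bihom (bideg c n (d (~~ c))) g & forall p, f p = fibre_eqn c P p * g p.
Proof.
move=> /(bihom_expand c) [u [hu fE]] dn f0.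
have [i Pi] := hcoord_neq0 P.
have rP (k : 'I_(d c).+1) : exists r, bihom (bideg c n 0) r /\ forall p,
    hcoord P i ^+ n.+1 * (hcoord (proj c p) 0 ^+ (d c - k) * hcoord (proj c p) 1 ^+ k)
    - hcoord (proj c p) i ^+ n.+1 * (hcoord P 0 ^+ (d c - k) * hcoord P 1 ^+ k)
    = fibre_eqn c P p * r p.
  have [|r] := @fibre_eqn_dvd_monomial c P n (d c - k) k i; last by exists r.
  by rewrite subnK // -ltnS.
have [r rE] := choice rP.
exists (fun p => (hcoord P i ^+ n.+1)^-1 * \sum_k r k p * u k (proj (~~ c) p)).
  apply: bihomZ; apply: bihom_sum => k.
  apply: bihom_ext (bihomM (proj1 (rE k)) (hu k)) => c0.
  by rewrite /bideg; case: (c) (c0) => -[] /=; rewrite ?addn0.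
move=> p; apply: (mulfI (expf_neq0 n.+1 Pi)).
rewrite [RHS]mulrCA mulVKf ?expf_neq0 //.
have := f0 (pt c P (proj (~~ c) p)); rewrite proj_pt => /(_ erefl).
rewrite fE proj_pt projN_pt => /(congr1 (fun t => hcoord (proj c p) i ^+ n.+1 * t)).
rewrite mulr0 => E; rewrite -[LHS]subr0 -[X in _ - X = _]E fE !mulr_sumr -sumrB.
apply: eq_bigr => k _.
by rewrite (mulrA (fibre_eqn c P p)) -(proj2 (rE k)) mulrBl !mulrA.
Qed.

(** Multiplying by a coordinate keeps numerators and denominators of the same
    bidegree, and covers the case where f has degree 0 along the base. *)
Lemma fibre_eqn_dvd_coord c P d f i : bihom d f ->
  (forall p, proj c p = P -> f p = 0) ->
  exists2 g, bihom d g & forall p, f p * hcoord (proj c p) i = fibre_eqn c P p * g p.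
Proof.
move=> bf f0; case dc : (d c) => [|n].
  exists (fun=> 0); first exact: bihom0.
  move=> p; have [u [_ fE]] := bihom_expand c bf.
  have := f0 (pt c P (proj (~~ c) p)); rewrite proj_pt => /(_ erefl).
  by rewrite !fE dc !big_ord1 projN_pt subnn !expr0 !mul1r => ->; rewrite mul0r mulr0.
have [g hg gE] := fibre_eqn_dvd bf dc f0.
exists (fun p => g p * hcoord (proj c p) i); last by move=> p; rewrite gE mulrA.
apply: bihom_ext (bihomM hg (bihom_coord c i)) => c0; rewrite /bideg.
by case: (c) (c0) dc => -[] /= dc; rewrite ?dc ?addn1 ?addn0.
Qed.

Lemma homog_dvd c P b u : homog c b.+1 u -> u P = 0 -> exists2 v,
  homog c b v & forall x, u x = (hcoord x 1 * hcoord P 0 - hcoord x 0 * hcoord P 1) * v x.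
Proof.
move=> hu uP; have cb : bideg c b.+1 0 c = b.+1 by rewrite /bideg eqxx.
have [|v hv vE] := @fibre_eqn_dvd c P _ _ b hu cb; first by move=> p ->.
exists (fun x => v (pt c x P)).
  have := @homog_slice (~~ c) _ _ P hv; rewrite negbK {1}/bideg eqxx.
  by apply: eq_bihom => p; case: (c).
by move=> x; have := vE (pt c x P); rewrite /fibre_eqn proj_pt.
Qed.

(** * Regular functions on the projective line *)

Lemma homog_root c b u : homog c b.+1 u -> exists x, u x = 0.
Proof.
move=> /homog_expand[a uE]; pose A := \poly_(k < b.+2) a k.
(* If the dehomogenized polynomial is a nonzero constant, then its top formal
   coefficient is zero, so the root is the point at infinity. *)
have [A1|/closed_rootP[t]] := eqVneq (size A) 1%N.
  have [|x [l [l0 x0 x1]]] := @P1_point 0 1; first by rewrite oner_neq0 orbT.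
  exists x; rewrite uE big_ord_recr /= big1 ?add0r.
    have := congr1 (fun B : {poly K} => B`_b.+1) (size1_polyC (eq_leq A1)).
    by rewrite coef_poly ltnSn coefC => ->; rewrite mulr0.
  move=> k _; rewrite x0 mulr0 expr0n /= subSn ?mul0r // -ltnS.
  exact: ltn_ord.
move=> /rootP At; have [|x [l [l0 x0 x1]]] := @P1_point 1 t; first by rewrite oner_neq0.
exists x; transitivity (l ^+ b.+1 * A.[t]); last by rewrite At mulr0.
rewrite uE horner_poly mulr_sumr; apply: eq_bigr => k _.
have -> : l ^+ b.+1 = l ^+ (b.+1 - k) * l ^+ k by rewrite -exprD subnK // -ltnS.
by rewrite x0 x1 mulr1 exprMn; ring.
Qed.

Definition regular_P1 c (w : P1 K -> K) := forall y, exists b G H,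
  [/\ homog c b G, homog c b H, H y != 0 &
      forall z, H z != 0 -> w z = G z / H z].

Lemma homogM c b b' u v : homog c b u -> homog c b' v ->
  homog c (b + b') (fun y => u y * v y).
Proof.
move=> hu hv; apply: bihom_ext (bihomM hu hv) => c0.
by rewrite /bideg; case: eqP.
Qed.

(** By irreducibility a fraction that represents w on a nonempty open set
    represents it wherever it makes sense. *)
Lemma regular_P1_density c w b b' G H v x : regular_P1 c w ->
  homog c b G -> homog c b H -> homog c b' v -> v x != 0 ->
  (forall z, v z != 0 -> G z = w z * H z) -> forall z, G z = w z * H z.
Proof.
move=> rw hG hH hv vx GH z; have [b1 [G1 [H1 [hG1 hH1 H1z wE]]]] := rw z.
pose F y := G y * H1 y - G1 y * H y.
have hF : homog c (b + b1) F.
  apply: bihomB; first exact: homogM.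
  by rewrite addnC; exact: homogM.
have F0 : forall y, v y * H1 y * F y = 0.
  move=> y; have [->|vy] := eqVneq (v y) 0; first by rewrite !mul0r.
  have [->|H1y] := eqVneq (H1 y) 0; first by rewrite mulr0 mul0r.
  suff -> : F y = 0 by rewrite mulr0.
  by rewrite /F GH // wE //; field.
have [y vH] : exists y, v y * H1 y != 0.
  apply: contrapT => /forallNP nex; case/eqP: H1z.
  apply: (homog_domain hv hH1 _ vx) => y.
  by have /negP := nex y; rewrite negbK => /eqP.
have /eqP := homog_domain (homogM hv hH1) hF F0 vH z.
rewrite subr_eq0 wE // => /eqP Gz.
by apply: (mulIf H1z); rewrite Gz; field.
Qed.

(** Represent w by a fraction G / H.  If H has positive degree then it has a
    root P, where G = w H vanishes too, so that the equation of P can be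
    cancelled; by induction H can be taken of degree 0. *)
Lemma regular_P1_cst c w : regular_P1 c w -> forall y z, w y = w z.
Proof.
move=> rw y0 z0; have [b [G [H [hG hH Hy wE]]]] := rw y0.
have GE : forall z, G z = w z * H z.
  by apply: (regular_P1_density rw hG hH hH Hy) => z Hz; rewrite wE // divfK.
elim: b G H hG hH GE y0 Hy {wE} z0 => [|b IH] G H hG hH GE y0 Hy z0.
  have [g gE] := homog_expand hG; have [h hE] := homog_expand hH.
  have := GE y0; have := GE z0; move: Hy.
  rewrite !gE !hE !big_ord1 !subnn !expr0 !mul1r => h0 -> /(mulIf h0).
  by [].
have [P HP] := homog_root hH.
have GP : G P = 0 by rewrite GE HP mulr0.
have [G1 hG1 G1E] := homog_dvd hG GP; have [H1 hH1 H1E] := homog_dvd hH HP.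
pose l x := hcoord x 1 * hcoord P 0 - hcoord x 0 * hcoord P 1.
have ly : l y0 != 0 by apply: contraNneq Hy => l0; rewrite H1E -/(l y0) l0 mul0r.
apply: (IH G1 H1 hG1 hH1 _ y0); last by apply: contraNneq Hy; rewrite H1E => ->; rewrite mulr0.
apply: (regular_P1_density rw hG1 hH1 (bihom_fibre_eqn c P) ly) => z lz.
by apply: (mulfI lz); rewrite mulrCA -H1E -G1E GE.
Qed.

(** * Regular functions on the quadric *)

(** Multiplying numerator and denominator by a form that cuts out the
    neighbourhood, the denominator itself can serve to define it. *)
Lemma regular_onP (U : set (quadric K)) f : regular_on U f <->
  forall p, U p -> exists d g h, [/\ bihom d g, bihom d h, h p != 0 &
    forall q, h q != 0 -> U q /\ f q = g q / h q].
Proof.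
split=> rf p Up.
  have [V [oV Vp VU [a [b [g [h gh]]]]]] := rf p Up.
  have [a' [b' [v [vp vV]]]] := oV p Vp.
  have bi m n (F : Defs.form K m n) : bihom (fun c => if c then n else m) (form_eval F).
    by exists F.
  exists (fun c => (if c then b' else a') + (if c then b else a))%N,
    (fun q => form_eval v q * form_eval g q), (fun q => form_eval v q * form_eval h q).
  split; [exact: (bihomM (bi _ _ v) (bi _ _ g))|exact: (bihomM (bi _ _ v) (bi _ _ h))| |].
    by rewrite mulf_neq0 //; have [] := gh p Vp.
  move=> q; rewrite mulf_eq0 negb_or => /andP[vq hq]; have Vq := vV q vq.
  by split; [exact: VU|rewrite (proj2 (gh q Vq)) -mulf_div divff ?mul1r].
have [d [g [h [[G GE] [H HE] hp hU]]]] := rf p Up.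
exists [set q | h q != 0]; split=> //.
- by move=> q hq; exists _, _, H; split=> [|q']; rewrite HE.
- by move=> q /hU[].
by exists _, _, G, H => q hq; rewrite GE HE; have [] := hU q hq.
Qed.

Lemma regular_on_local (U : set (quadric K)) f :
  (forall p, U p -> exists V, [/\ zopen V, V p, V `<=` U & regular_on V f]) ->
  regular_on U f.
Proof.
move=> loc p Up; have [V [_ Vp VU rf]] := loc p Up.
have [W [oW Wp WV gh]] := rf p Vp.
by exists W; split=> // q /WV /VU.
Qed.

Lemma regular_on_neq0 (U : set (quadric K)) f : zopen U -> regular_on U f ->
  zopen [set p | U p /\ f p != 0] /\
  regular_on [set p | U p /\ f p != 0] (fun p => (f p)^-1).
Proof.
move=> oU /regular_onP rf; have loc p : U p -> f p != 0 -> exists d g h,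
    [/\ bihom d g, bihom d h, h p != 0, g p != 0 &
     forall q, h q != 0 -> g q != 0 -> [/\ U q, f q != 0 & f q = g q / h q]].
  move=> Up fp; have [d [g [h [bg bh hp E]]]] := rf p Up.
  exists d, g, h; split=> //.
    by apply: contraNneq fp => gp; rewrite (proj2 (E p hp)) gp mul0r.
  by move=> q hq gq; have [Uq ->] := E q hq; split=> //; rewrite mulf_neq0 ?invr_neq0.
split.
  move=> p [Up fp]; have [d [g [h [bg bh hp gp E]]]] := loc p Up fp.
  have [G GE] := bihomM bg bh; exists _, _, G; rewrite GE; split.
    by rewrite mulf_neq0.
  move=> q; rewrite GE mulf_eq0 negb_or => /andP[gq hq].
  by have [] := E q hq gq.
apply/regular_onP => p [Up fp]; have [d [g [h [bg bh hp gp E]]]] := loc p Up fp.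
exists (fun c => d c + d c)%N, (fun q => h q * h q), (fun q => g q * h q).
split; [exact: bihomM|exact: bihomM|by rewrite mulf_neq0|].
move=> q; rewrite mulf_eq0 negb_or => /andP[gq hq].
by have [Uq fq ->] := E q hq gq; split; [split=> //; have [] := E q hq gq|field; rewrite gq hq].
Qed.

(** The complement of a fibre is dense. *)
Lemma bihom_fibre_eqn_eq0 c P d f : bihom d f ->
  (forall q, f q * fibre_eqn c P q = 0) -> forall q, f q = 0.
Proof.
move=> bf fl0 q; have [Q lQ] : exists Q, fibre_eqn c P Q != 0.
  have [|x [l [l0 x0 x1]]] := @P1_point (hcoord P 0 == 0)%:R (hcoord P 0 != 0)%:R.
    by case: (hcoord P 0 == 0); rewrite oner_neq0 ?orbT.
  exists (pt c x x); rewrite /fibre_eqn proj_pt x0 x1 -!mulrA -mulrBr mulf_neq0 //.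
  case: eqP (hcoord_neq0_or P) => /= [-> |/eqP] P0; first by rewrite mul0r sub0r mul1r oppr_eq0.
  by rewrite mul1r mul0r subr0.
apply: (bihom_domain (bihom_fibre_eqn c P) bf _ lQ) => q'.
by rewrite mulrC.
Qed.

Lemma regular_on_density c P (U : set (quadric K)) f g :
  regular_on U f -> regular_on U g ->
  (forall q, U q -> fibre_eqn c P q != 0 -> f q = g q) -> forall q, U q -> f q = g q.
Proof.
move=> /regular_onP rf /regular_onP rg fg p Up.
have [d [g1 [h1 [bg1 bh1 h1p E1]]]] := rf p Up.
have [e [g2 [h2 [bg2 bh2 h2p E2]]]] := rg p Up.
have bF : bihom (fun c => d c + e c)%N (fun q => g1 q * h2 q - h1 q * g2 q).
  by apply: bihomB; apply: bihomM.
have bv := bihomM bh1 bh2.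
have := bihom_fibre_eqn_eq0 (c := c) (P := P) (bihomM bv bF) => /(_ _ p) F0.
have : h1 p * h2 p * (g1 p * h2 p - h1 p * g2 p) = 0.
  apply: F0 => q.
  have [->|l0] := eqVneq (fibre_eqn c P q) 0; first by rewrite mulr0.
  have [->|h1q] := eqVneq (h1 q) 0; first by rewrite !mul0r.
  have [->|h2q] := eqVneq (h2 q) 0; first by rewrite mulr0 !mul0r.
  have [Uq f1] := E1 q h1q; have [_ f2] := E2 q h2q.
  move/eqP: (fg q Uq l0); rewrite f1 f2 eqr_div // => /eqP ->.
  by rewrite [g2 q * _]mulrC subrr mulr0 mul0r.
move/eqP; rewrite !mulf_eq0 (negPf h1p) (negPf h2p) /= subr_eq0 => /eqP E.
rewrite (proj2 (E1 p h1p)) (proj2 (E2 p h2p)); apply/eqP.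
by rewrite eqr_div // E mulrC.
Qed.

(** The quotient of f by the equation of the fibre, made of degree 0 by a
    coordinate, is locally a fraction by divisibility of the numerator.  The
    local fractions agree off the fibre, hence everywhere by density. *)
Lemma regular_on_dvd c P (i : 'I_2) (U : set (quadric K)) f : zopen U ->
  regular_on U f -> (forall q, U q -> proj c q = P -> f q = 0) ->
  exists2 g, regular_on U g &
    forall q, U q -> f q * hcoord (proj c q) i = fibre_eqn c P q * g q.
Proof.
move=> oU /regular_onP rf f0.
(* On the fibre the quotient f / l is not determined by pointwise division, so
   its value at p is taken from an arbitrary fraction valid around p. *)
pose R p t := exists d g h, [/\ bihom d g, bihom d h, h p != 0, t = g p / h p &
  forall q, h q != 0 -> U q /\ f q * hcoord (proj c q) i = fibre_eqn c P q * (g q / h q)].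
have loc p : exists t, U p -> R p t.
  have [Up|nUp] := pselect (U p); last by exists 0.
  have [d [g [h [bg bh hp E]]]] := rf p Up.
  (* Away from the neighbourhood of p, g need not vanish on the fibre, but
     there h does. *)
  have gh0 q : proj c q = P -> g q * h q = 0.
    move=> qP; have [->|hq] := eqVneq (h q) 0; first by rewrite mulr0.
    have [Uq fq] := E q hq; move: fq; rewrite f0 // => /esym/eqP.
    by rewrite mulf_eq0 invr_eq0 (negPf hq) orbF => /eqP ->; rewrite mul0r.
  have [g1 bg1 g1E] := fibre_eqn_dvd_coord i (bihomM bg bh) gh0.
  exists (g1 p / (h p * h p)) => _; exists (fun c => d c + d c)%N, g1, (fun q => h q * h q).
  split=> //; [exact: bihomM|by rewrite mulf_neq0|].
  move=> q; rewrite mulf_eq0 orbb => hq; have [Uq ->] := E q hq; split=> //.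
  by rewrite mulrA -g1E; field.
have [g gR] := choice loc; exists g; last first.
  move=> q Uq; have [d [u [h [bu bh hq -> E]]]] := gR q Uq.
  by have [] := E q hq.
apply/regular_onP => p Up; have [d [u [h [bu bh hp _ E]]]] := gR p Up.
exists d, u, h; split=> // q hq; have [Uq _] := E q hq; split=> //.
have [d' [u' [h' [bu' bh' h'q -> E']]]] := gR q Uq.
pose W := [set q | h q != 0 /\ h' q != 0].
have reg d1 g1 h1 : bihom d1 g1 -> bihom d1 h1 -> (forall q, W q -> h1 q != 0) ->
    regular_on W (fun q => g1 q / h1 q).
  move=> b1 b2 W1; apply/regular_onP => q1 [hq1 h'q1].
  exists (fun c => d c + d' c + d1 c)%N, (fun q => h q * h' q * g1 q), (fun q => h q * h' q * h1 q).
  split; [exact: bihomM (bihomM bh bh') b1|exact: bihomM (bihomM bh bh') b2|by rewrite !mulf_neq0 ?W1|].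
  move=> q2; rewrite !mulf_eq0 !negb_or -andbA => /and3P[A B C]; split=> //.
  by field; rewrite A B C.
apply: (@regular_on_density c P W (fun q => u' q / h' q) (fun q => u q / h q)).
- by apply: reg bu' bh' _ => ? [].
- by apply: reg bu bh _ => ? [].
- by move=> q1 [h1 h2] lq; apply: (mulfI lq); rewrite -(proj2 (E q1 h1)) -(proj2 (E' q1 h2)).
by [].
Qed.
End Forms.

(** * The line bundles on the quadric *)

Section LineBundles.
Variable K : closedFieldType.
Implicit Types (c : bool) (p q : quadric K) (I J L : 'I_2 * 'I_2) (m n : bool -> int).

Definition idx c I := if c then I.2 else I.1.

Definition coord_ratio c I J p := hcoord (proj c p) (idx c J) / hcoord (proj c p) (idx c I).

(** The transition function of O(n). *)
Definition weight n I J p := coord_ratio true I J p ^ n true * coord_ratio false I J p ^ n false.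

(** O(a, b) with the pair of weights indexed by the factor, as needed to treat
    the two rulings at once. *)
Definition OQw n := OQ K (n false) (n true).

Lemma trans_O n I J p : trans (b := OQw n) I J p = (weight n I J p)%:M.
Proof. by rewrite [LHS]mx11_scalar /= !mxE !eqxx !mulr1n. Qed.

Lemma chart_O n I p : chart (b := OQw n) I p <-> forall c, hcoord (proj c p) (idx c I) != 0.
Proof. by split=> [[? ?] []|H] //; split; [apply: (H false)|apply: (H true)]. Qed.

Lemma weightC c n I J p :
  weight n I J p = coord_ratio c I J p ^ n c * coord_ratio (~~ c) I J p ^ n (~~ c).
Proof. by case: c => //=; rewrite /weight mulrC. Qed.

Section OneChart.
Variables (I J : 'I_2 * 'I_2) (p : quadric K).
Hypothesis (cI : forall c, hcoord (proj c p) (idx c I) != 0).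
Hypothesis (cJ : forall c, hcoord (proj c p) (idx c J) != 0).

Lemma coord_ratio_neq0 c : coord_ratio c I J p != 0.
Proof. by rewrite mulf_neq0 ?invr_neq0. Qed.

Lemma weight_neq0 n : weight n I J p != 0.
Proof. by rewrite mulf_neq0 // expfz_neq0 // coord_ratio_neq0. Qed.

Lemma weightD m n : weight (fun c => m c + n c) I J p = weight m I J p * weight n I J p.
Proof. by rewrite /weight !expfzDr ?coord_ratio_neq0 //; ring. Qed.

Lemma weightN n : weight (fun c => - n c) I J p = weight n J I p.
Proof.
rewrite /weight; have inv c : coord_ratio c I J p ^ (- n c) = coord_ratio c J I p ^ n c.
  by rewrite -exprz_inv /coord_ratio invf_div.
by rewrite !inv.
Qed.

Lemma weight1 c n : idx c I = idx c J -> n (~~ c) = 0 -> weight n I J p = 1.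
Proof.
by move=> IJ n0; rewrite (weightC c) n0 expr0z mulr1 /coord_ratio IJ divff ?cJ // exp1rz.
Qed.
End OneChart.

Lemma family_O n (s : Defs.family (OQw n)) (U : set (quadric K)) I J p : is_section U s ->
  U p -> chart (b := OQw n) I p -> chart (b := OQw n) J p ->
  s I p 0 0 = weight n I J p * s J p 0 0.
Proof.
move=> [_ H] Up cI cJ; rewrite (H I J) // trans_O.
by rewrite mul_scalar_mx mxE.
Qed.

(** On a fibre of the projection c, the bundle O(n) is trivial as its weight
    along the fibre is 0: in the charts where a fixed coordinate of the base is
    nonzero, the section is a regular function on the fibre, hence constant. *)
Lemma section_fibre_eq0 c n (s : Defs.family (OQw n)) I J p q :
  is_section setT s -> n (~~ c) = 0 -> proj c p = proj c q ->
  chart (b := OQw n) I p -> chart (b := OQw n) J q ->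
  s I p 0 0 = 0 -> s J q 0 0 = 0.
Proof.
move=> ss n0 pq cI cJ sp.
pose x := proj c p; have [i xi] := hcoord_neq0 x.
have [j jP] := choice (@hcoord_neq0 K).
pose N y : 'I_2 * 'I_2 := if c then (j y, i) else (i, j y).
have idxN y : idx c (N y) = i by rewrite /N; case: (c).
have cN y : chart (b := OQw n) (N y) (pt c x y).
  apply/chart_O => c0; have [->|cc0] := eqVneq c0 c; first by rewrite proj_pt idxN.
  have -> : c0 = ~~ c by case: (c) (c0) cc0 => -[].
  by rewrite projN_pt /N; case: (c); apply: jP.
pose w y := s (N y) (pt c x y) 0 0.
have rw : regular_P1 (~~ c) w.
  move=> y; have /regular_onP rs := ss.1 (N y) 0.
  have [|d [g [h [bg bh hy E]]]] := rs (pt c x y); first by split=> //; exact: cN.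
  exists (d (~~ c)), (fun z => g (pt c x z)), (fun z => h (pt c x z)).
  split=> //; [exact: homog_slice|exact: homog_slice|].
  move=> z hz; have [[_ cz] <-] := E _ hz.
  rewrite (family_O ss _ cz (cN z)) // (@weight1 _ _ _ _ c) ?idxN ?mul1r //.
  exact/(chart_O n).
have wE r M : proj c r = x -> chart (b := OQw n) M r -> s M r 0 0 = 0 <->
    w (proj (~~ c) r) = 0.
  move=> rx cM; have rE : pt c x (proj (~~ c) r) = r by rewrite -rx pt_proj.
  have := cN (proj (~~ c) r); rewrite /w rE => cr; rewrite (family_O ss _ cr cM) //.
  split=> [->|/eqP]; first by rewrite mulr0.
  rewrite mulf_eq0 => /orP[|/eqP//].
  by rewrite (negPf (weight_neq0 _ _ _)) //; exact/(chart_O n).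
apply: (proj2 (wE q J (esym pq) cJ)).
by rewrite -(regular_P1_cst rw (proj (~~ c) p)); apply: (proj1 (wE p I erefl cI)).
Qed.
End LineBundles.

(** * Sections of bundles and morphisms *)

Section Sections.
Variable K : closedFieldType.
Implicit Types (p q : quadric K) (U V : set (quadric K)).

Lemma regular_on_mulmx U a b c (A : quadric K -> 'M[K]_(a, b)) (B : quadric K -> 'M[K]_(b, c)) :
  zopen U -> (forall i j, regular_on U (fun p => A p i j)) ->
  (forall i j, regular_on U (fun p => B p i j)) ->
  forall i j, regular_on U (fun p => (A p *m B p) i j).
Proof.
move=> oU rA rB i j; apply: (@eq_regular_on _ U (fun p => \sum_k A p i k * B p k j)).
  by move=> p _; rewrite mxE.
by apply: regular_on_sum => // k; apply: regular_onM.
Qed.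

Lemma local_section r (E : bundle K r) e V (v : quadric K -> 'cV[K]_r) :
  zopen V -> V `<=` chart (b := E) e ->
  (forall k, regular_on V (fun p => v p k 0)) ->
  is_section V (fun i p => trans (b := E) i e p *m v p).
Proof.
move=> oV Ve rv; split=> [i k|i j p Vp ci cj]; last first.
  by rewrite mulmxA trans_cocycle //; apply: Ve.
have oW : zopen (V `&` chart (b := E) i) by apply: zopenI => //; apply: zopen_chart.
apply: regular_on_mulmx => // [a b|a b].
  by apply: regular_onS oW _ (regular_trans a b) => p [/Ve].
by rewrite ord1; apply: regular_onS oW _ (rv a) => p [].
Qed.

Lemma morphism_section r r' (E : bundle K r) (F : bundle K r') (phi : morphism E F)
    U (s : Defs.family E) : zopen U -> is_section U s ->
  exists2 t, is_section U t & maps_to phi U s t.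
Proof.
move=> oU [rs ss]; have [i iP] := choice (chart_cover E).
have phiE k l a b p : U p -> chart (b := F) k p -> chart (b := F) l p -> chart (b := E) a p ->
    chart (b := E) b p -> mor phi l b p *m s b p = trans (b := F) l k p *m (mor phi k a p *m s a p).
  move=> Up ck cl ca cb; rewrite -(mor_compat phi ck cl ca cb) (ss a b) //.
  by rewrite !mulmxA.
exists (fun k p => mor phi k (i p) p *m s (i p) p); last first.
  by move=> k a p Up ck ca; rewrite (phiE k k (i p) a) // trans_id // mul1mx.
split=> [k a|k l p Up ck cl]; last exact: phiE.
apply: regular_on_local => p [Up ck].
have oV : zopen (U `&` chart (b := F) k `&` chart (b := E) (i p)).
  by apply: zopenI; [apply: zopenI => //|]; apply: zopen_chart.
exists (U `&` chart (b := F) k `&` chart (b := E) (i p)); split=> //.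
apply: (@eq_regular_on _ _ (fun q => (mor phi k (i p) q *m s (i p) q) a 0)).
  by move=> q [[Uq cq] ciq]; rewrite (phiE k k (i q) (i p)) // trans_id // mul1mx.
apply: regular_on_mulmx => // [a' b'|a' b'].
  by apply: regular_onS oV _ (regular_mor phi a' b') => q [[]].
by rewrite ord1; apply: regular_onS oV _ (rs (i p) a') => q [[]].
Qed.

(** Global sections span each fibre of the bundle: a local section with
    prescribed value at p is there a combination of global ones. *)
Lemma globally_generated_fibre r (E : bundle K r) e p (l : 'rV[K]_r) :
  globally_generated E -> chart (b := E) e p -> l != 0 ->
  exists2 t : Defs.family E, is_section setT t & l *m t e p != 0.
Proof.
move=> gg ep l0; have [i [k]] := matrix_neq0 l0.
rewrite {i}ord1 => lk.
have oV : zopen (chart (b := E) e) by apply: zopen_chart.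
have ss : is_section (chart (b := E) e)
    (fun i q => trans (b := E) i e q *m (delta_mx k 0 : 'cV[K]_r)).
  by apply: local_section => // a; apply: regular_on_cst.
have [V [_ Vp Ve [n [s [f [sS _ sE]]]]]] := gg _ _ oV ss p ep.
apply: contrapT => nt; case/eqP: lk.
have := congr1 (fun v => (l *m v) 0 0) (sE e p Vp ep); rewrite /= trans_id // mul1mx.
rewrite -colE mxE => ->; rewrite mulmx_sumr summxE big1 // => a _.
rewrite -scalemxAr mxE; suff -> : l *m s a e p = 0 by rewrite mxE mulr0.
by apply/eqP/negPn/negP => H; apply: nt; exists (s a).
Qed.
End Sections.

(** * Wedge product with a plane vector *)

(** The linear form w |-> v /\ w on the plane. *)
Definition wedge (R : comNzRingType) (v : 'cV[R]_2) : 'rV[R]_2 :=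
  \row_j (if j == 0 then - v 1 0 else v 0 0).

Section Wedge.
Variable R : comNzRingType.
Implicit Types (v w : 'cV[R]_2) (A : 'M[R]_2).

Lemma sum_ord2 (f : 'I_2 -> R) : \sum_i f i = f 0 + f 1.
Proof.
rewrite big_ord_recl big_ord_recl big_ord0 addr0.
by congr (_ + f _); apply: val_inj.
Qed.

Lemma det_mx2 A : \det A = A 0 0 * A 1 1 - A 0 1 * A 1 0.
Proof.
rewrite (expand_det_row _ 0) sum_ord2 /cofactor !det_mx11 !mxE /=.
have -> : lift 0 0 = 1 :> 'I_2 by exact: val_inj.
have -> : lift 1 0 = 0 :> 'I_2 by exact: val_inj.
by rewrite expr0 expr1; ring.
Qed.

Lemma wedgeE v w : (wedge v *m w) 0 0 = v 0 0 * w 1 0 - v 1 0 * w 0 0.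
Proof. by rewrite mxE sum_ord2 !mxE /=; ring. Qed.

Lemma wedge_mulmx A v : wedge (A *m v) *m A = \det A *: wedge v.
Proof.
by apply/rowP; apply: ord2P; rewrite mxE sum_ord2 !mxE !sum_ord2 det_mx2 /=; ring.
Qed.

Lemma wedgeZ a v : wedge (a *: v) = a *: wedge v.
Proof. by apply/rowP; apply: ord2P; rewrite !mxE /= ?mulrN. Qed.

Lemma wedge0 : wedge (0 : 'cV[R]_2) = 0.
Proof. by apply/rowP; apply: ord2P; rewrite !mxE /= ?oppr0. Qed.

Lemma wedge_eq0 v : wedge v = 0 -> v = 0.
Proof.
move=> /rowP w0; apply/colP; apply: ord2P.
  by have := w0 1; rewrite !mxE.
by have := w0 0; rewrite !mxE /= => /eqP; rewrite oppr_eq0 => /eqP.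
Qed.

Lemma wedge_self v : wedge v *m v = 0.
Proof. by apply/matrixP => i j; rewrite !ord1 wedgeE mxE; ring. Qed.
End Wedge.

Lemma wedge_kernel (F : fieldType) (v w : 'cV[F]_2) k :
  wedge v *m w = 0 -> v k 0 != 0 -> w = (w k 0 / v k 0) *: v.
Proof.
move=> /(congr1 (fun M : 'M_1 => M 0 0)); rewrite wedgeE mxE => /eqP.
rewrite subr_eq0 => /eqP E vk; apply/colP => i; rewrite mxE.
apply: (mulIf vk); rewrite mulrAC divfK //.
move: k i {vk} E; apply: ord2P; apply: ord2P => E //.
  by rewrite mulrC E mulrC.
by rewrite mulrC -E mulrC.
Qed.

(** * The sequence attached to a section of a rank 2 bundle *)

Section Extension.
Variables (K : closedFieldType) (E : bundle K 2) (m m' : bool -> int).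
Implicit Types (p q : quadric K) (e : Defs.index E) (I J L : 'I_2 * 'I_2) (c : bool).

Definition twistw (n : bool -> int) := tensor_line E (OQw K n).

Variable s : Defs.family (twistw (fun c => - m c)).
Hypothesis ss : is_section setT s.

Lemma twist_family e e' I J p : chart (b := E) e p -> chart (b := E) e' p ->
  chart (b := OQw K m) I p -> chart (b := OQw K m) J p ->
  s (e, I) p = weight m J I p *: (trans (b := E) e e' p *m s (e', J) p).
Proof.
move=> ce ce' cI cJ; rewrite (ss.2 (e, I) (e', J)) //=.
have := trans_O (fun c => - m c) I J p.
move=> /(congr1 (fun M : 'M_1 => M 0 0)); rewrite /= [RHS]mxE eqxx mulr1n => ->.
by rewrite weightN ?scalemxAl //; exact/(chart_O m).
Qed.

Lemma regular_twist_family e I k :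
  regular_on (chart (b := E) e `&` chart (b := OQw K m) I) (fun p => s (e, I) p k 0).
Proof.
have := ss.1 (e, I) k; apply: regular_onS.
  by apply: zopenI; apply: zopen_chart.
by [].
Qed.

Lemma section_mor_compat e e' I J p : chart (b := E) e p -> chart (b := E) e' p ->
  chart (b := OQw K m) I p -> chart (b := OQw K m) J p ->
  trans (b := E) e' e p *m s (e, I) p *m trans (b := OQw K m) I J p = s (e', J) p.
Proof.
move=> ce ce' cI cJ.
by rewrite (twist_family ce' ce cJ cI) trans_O -mulmxA mul_mx_scalar -scalemxAr.
Qed.

(** A section of E(-m) is the same as a morphism from O(m) to E. *)
Definition section_mor : morphism (OQw K m) E.
Proof.
apply: (@Morphism K _ _ (OQw K m) E (fun e I p => s (e, I) p)) => [e I a b|].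
  by rewrite ord1; apply: regular_twist_family.
exact: section_mor_compat.
Defined.

Variable delta : morphism (det_bundle E) (OQw K (fun c => m c + m' c)).

Lemma delta_compat I J e e' p : chart (b := OQw K m) I p -> chart (b := OQw K m) J p ->
  chart (b := E) e p -> chart (b := E) e' p ->
  mor delta J e' p 0 0 = weight m J I p * weight m' J I p * mor delta I e p 0 0
     * \det (trans (b := E) e e' p).
Proof.
move=> cI cJ ce ce'; rewrite -(mor_compat delta cI cJ ce ce') trans_O.
rewrite mul_scalar_mx /= mul_mx_scalar !mxE weightD; first by ring.
  exact/(chart_O m).
exact/(chart_O m).
Qed.

(** The morphism t |-> s /\ t, brought to O(m') by the isomorphism between
    det E and O(m + m'). *)
Definition contraction I e p : 'rV[K]_2 := mor delta I e p 0 0 *: wedge (s (e, I) p).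

Lemma regular_contraction I e a b :
  regular_on (chart (b := OQw K m') I `&` chart (b := E) e) (fun p => contraction I e p a b).
Proof.
have oU : zopen (chart (b := OQw K m) I `&` chart (b := E) e).
  by apply: zopenI; apply: zopen_chart.
have rs k : regular_on (chart (b := OQw K m) I `&` chart (b := E) e) (fun p => s (e, I) p k 0).
  by rewrite setIC; apply: regular_twist_family.
apply: (@eq_regular_on _ _ (fun p => mor delta I e p 0 0 * wedge (s (e, I) p) 0 b)).
  by move=> p _; rewrite /contraction ord1 [RHS]mxE.
apply: regular_onM; first exact: (@regular_mor _ _ _ _ _ delta I e 0 0).
move: b; apply: ord2P.
  apply: (@eq_regular_on _ _ (fun p => -1 * s (e, I) p 1 0)).
    by move=> p _; rewrite mxE mulN1r.
  by apply: regular_onM => //; apply: regular_on_cst.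
by apply: eq_regular_on (rs 0) => p _; rewrite mxE.
Qed.

Lemma contraction_compat I J e e' p :
  chart (b := OQw K m') I p -> chart (b := OQw K m') J p ->
  chart (b := E) e p -> chart (b := E) e' p ->
  trans (b := OQw K m') J I p *m contraction I e p *m trans (b := E) e e' p
  = contraction J e' p.
Proof.
move=> cI cJ ce ce'.
rewrite /contraction (twist_family ce ce' cI cJ) (delta_compat cI cJ ce ce') trans_O.
rewrite wedgeZ mul_scalar_mx -!scalemxAl wedge_mulmx !scalerA.
by congr (_ *: _); ring.
Qed.

Definition wedge_mor : morphism E (OQw K m') :=
  @Morphism K _ _ E (OQw K m') contraction regular_contraction contraction_compat.

Hypothesis delta_neq0 : forall I e p, chart (b := OQw K m) I p -> chart (b := E) e p ->
  mor delta I e p 0 0 != 0.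

(** Global generation provides, at a point q where s is nonzero, a global t
    with s /\ t nonzero at q.  But s /\ t is a section of O(m') vanishing at p,
    hence on the fibre. *)
Lemma vanishing_on_fibre c e e' I J p q : globally_generated E -> m' (~~ c) = 0 ->
  proj c p = proj c q ->
  chart (b := E) e p -> chart (b := OQw K m) I p ->
  chart (b := E) e' q -> chart (b := OQw K m) J q ->
  s (e, I) p = 0 -> s (e', J) q = 0.
Proof.
move=> gg m'0 pq ce cI ce' cJ sp; apply: wedge_eq0.
apply/eqP/negPn/negP => sq.
have [|t st] := @globally_generated_fibre _ _ E e' q (contraction J e' q) gg ce'.
  by rewrite scaler_eq0 negb_or delta_neq0.
have [u su tu] := morphism_section wedge_mor (@zopenT K) st.
rewrite (tu J e' q) // => /eqP[]; apply/matrixP => i j; rewrite !ord1 mxE.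
apply: (section_fibre_eq0 (c := c) (I := I) (p := p) su) => //.
rewrite -(tu I e p) //= /contraction sp wedge0 scaler0 mul0mx.
by rewrite mxE.
Qed.

Hypothesis s_neq0 : forall e I p, chart (b := E) e p -> chart (b := OQw K m) I p ->
  s (e, I) p != 0.

Lemma contraction_neq0 I e p : chart (b := E) e p -> chart (b := OQw K m) I p ->
  contraction I e p != 0.
Proof.
move=> ce cI; rewrite scaler_eq0 negb_or delta_neq0 //=.
by apply: contraNneq (s_neq0 ce cI) => /wedge_eq0 ->.
Qed.

Lemma section_mor_inj U (a : Defs.family (OQw K m)) : zopen U -> is_section U a ->
  maps_to section_mor U a (@zero_section K _ E) -> eq_on U a (@zero_section K _ (OQw K m)).
Proof.
move=> _ _ sa I p Up cI; have [e ce] := chart_cover E p.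
have [k [j]] := matrix_neq0 (s_neq0 ce cI); rewrite {j}ord1 => sk.
have /(congr1 (fun M : 'cV_2 => M k 0)) := sa e I p Up ce cI.
rewrite /= mxE big_ord1 mxE => /eqP; rewrite mulf_eq0 (negPf sk) /= => /eqP a0.
by apply/matrixP => i j; rewrite !ord1 a0 mxE.
Qed.

Lemma wedge_section_mor U (a : Defs.family (OQw K m)) (t : Defs.family E) :
  maps_to section_mor U a t -> maps_to wedge_mor U t (@zero_section K _ (OQw K m')).
Proof.
move=> at_ I e p Up cI ce; rewrite -(at_ e I p) //= mulmxA /contraction.
by rewrite -scalemxAl wedge_self scaler0 mul0mx.
Qed.

(** Near a point where the k-th component of s is nonzero, a section t with
    s /\ t = 0 is s multiplied by the ratio of the k-th components. *)
Lemma wedge_mor_kernel U (t : Defs.family E) : zopen U -> is_section U t ->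
  maps_to wedge_mor U t (@zero_section K _ (OQw K m')) ->
  forall p, U p -> exists V (a : Defs.family (OQw K m)),
    [/\ zopen V, V p, V `<=` U, is_section V a & maps_to section_mor V a t].
Proof.
move=> oU st t0 p Up; have [e ce] := chart_cover E p.
have [I cI] := chart_cover (OQw K m) p.
have [k [j]] := matrix_neq0 (s_neq0 ce cI); rewrite {j}ord1 => sk.
pose W := chart (b := E) e `&` chart (b := OQw K m) I.
have oW : zopen W by apply: zopenI; apply: zopen_chart.
have [oV rV] := regular_on_neq0 oW (@regular_twist_family e I k).
pose V := U `&` [set q | W q /\ s (e, I) q k 0 != 0].
have oVU : zopen V by apply: zopenI.
have sV : @is_section K 1 (OQw K m) V (fun J q => trans (b := OQw K m) J I q *m (t e q k 0 / s (e, I) q k 0)%:M).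
  apply: local_section => // [q [_ [[]]] //|i].
  apply: (@eq_regular_on _ _ (fun q => t e q k 0 * (s (e, I) q k 0)^-1)).
    by move=> q _; rewrite ord1 mxE eqxx mulr1n.
  apply: regular_onM; last by apply: regular_onS oVU _ rV => q [].
  by apply: regular_onS oVU _ (st.1 e k) => q [Uq [[cq _] _]].
exists V, (fun J q => trans (b := OQw K m) J I q *m (t e q k 0 / s (e, I) q k 0)%:M).
split=> //; first by move=> q [].
move=> e' J q [Uq [[ceq cIq] skq]] ce' cJ /=.
rewrite -(section_mor_compat ceq ce' cIq cJ) (mulmxA _ (trans (b := OQw K m) J I q)).
rewrite -(mulmxA _ (trans (b := OQw K m) I J q)) trans_cocycle // trans_id // mulmx1.
rewrite mul_mx_scalar scalemxAr -wedge_kernel //; first by rewrite (st.2 e' e).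
have /eqP := t0 I e q Uq cIq ceq; rewrite /= /contraction -scalemxAl scaler_eq0.
by rewrite (negPf (delta_neq0 cIq ceq)) => /eqP.
Qed.

Lemma wedge_mor_surj U (u : Defs.family (OQw K m')) : zopen U -> is_section U u ->
  forall p, U p -> exists V (t : Defs.family E),
    [/\ zopen V, V p, V `<=` U, is_section V t & maps_to wedge_mor V t u].
Proof.
move=> oU su p Up; have [e ce] := chart_cover E p.
have [I cI] := chart_cover (OQw K m') p.
have [i [k]] := matrix_neq0 (contraction_neq0 ce cI); rewrite {i}ord1 => ck.
pose W := chart (b := OQw K m') I `&` chart (b := E) e.
have oW : zopen W by apply: zopenI; apply: zopen_chart.
have [oV rV] := regular_on_neq0 oW (@regular_contraction I e 0 k).
pose V := U `&` [set q | W q /\ contraction I e q 0 k != 0].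
have oVU : zopen V by apply: zopenI.
pose v q : 'cV[K]_2 := (u I q 0 0 / contraction I e q 0 k) *: delta_mx k 0.
have sV : @is_section K 2 E V (fun e' q => trans (b := E) e' e q *m v q).
  apply: local_section => // [q [_ [[]]] //|i].
  apply: (@eq_regular_on _ _ (fun q => (u I q 0 0 * (contraction I e q 0 k)^-1) * (delta_mx k 0 : 'cV[K]_2) i 0)).
    by move=> q _; rewrite [RHS]mxE.
  apply: regular_onM; last exact: regular_on_cst.
  apply: regular_onM; last by apply: regular_onS oVU _ rV => q [].
  by apply: regular_onS oVU _ (su.1 I 0) => q [Uq [[cq _] _]].
exists V, (fun e' q => trans (b := E) e' e q *m v q).
split=> //; first by move=> q [].
move=> J e' q [Uq [[cIq ceq] ckq]] cJ ce' /=.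
rewrite -(contraction_compat cIq cJ ceq ce') (mulmxA _ (trans (b := E) e' e q)).
rewrite -(mulmxA _ (trans (b := E) e e' q)) trans_cocycle // trans_id // mulmx1.
rewrite (su.2 J I) // -mulmxA; congr (_ *m _).
rewrite -scalemxAr -colE; apply/matrixP => a b; rewrite !ord1 [LHS]mxE [X in _ * X]mxE.
by rewrite divfK.
Qed.

Lemma nowhere_zero_extension : extension (OQw K m) E (OQw K m').
Proof.
exists section_mor, wedge_mor; split.
- by move=> U a oU; exact: section_mor_inj.
- by move=> U a t _ _ _; exact: wedge_section_mor.
- by move=> U t oU; exact: wedge_mor_kernel.
- by move=> U u oU; exact: wedge_mor_surj.
Qed.
End Extension.

(** * The section attached to an index vanishes nowhere *)

(** The chartwise quotients of s by the equation of the fibre glue to a section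
    of the smaller twist: off the fibre the transition functions are forced,
    and by density they are right on the fibre too. *)
Lemma twist_divide K (E : bundle K 2) (m m1 : bool -> int) c P
    (s : Defs.family (twistw E (fun c => - m c))) : is_section setT s ->
  m1 c = m c + 1 -> m1 (~~ c) = m (~~ c) ->
  (forall e I p, chart (b := E) e p -> chart (b := OQw K m) I p -> proj c p = P -> s (e, I) p = 0) ->
  ~ eq_on setT s (@zero_section K _ (twistw E (fun c => - m c))) ->
  h0_neq0 (twistw E (fun c => - m1 c)).
Proof.
move=> ss m1c m1Nc s0 sn0.
have dvd (i : Defs.index (twistw E (fun c => - m c))) : exists g : 'I_2 -> quadric K -> K,
    forall k, regular_on (chart i) (g k) /\ forall q, chart i q ->
      s i q k 0 * hcoord (proj c q) (idx c i.2) = fibre_eqn c P q * g k q.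
  suff dvdk k : exists g, regular_on (chart i) g /\ forall q, chart i q ->
      s i q k 0 * hcoord (proj c q) (idx c i.2) = fibre_eqn c P q * g q.
    by have [g gP] := choice dvdk; exists g.
  have [|||g rg gE] := @regular_on_dvd K c P (idx c i.2) (chart i) (fun q => s i q k 0).
  - exact: zopen_chart.
  - by have := ss.1 i k; rewrite setTI.
  - by case: i => e I q [ce cI] qP; rewrite s0 // mxE.
  by exists g.
have [g gP] := choice dvd; pose s1 i q : 'cV[K]_2 := \col_k g i k q.
have s1E i q : chart (b := twistw E (fun c => - m c)) i q ->
    hcoord (proj c q) (idx c i.2) *: s i q = fibre_eqn c P q *: s1 i q.
  move=> ci; apply/colP => k; rewrite !mxE mulrC.
  exact: (proj2 (gP i k) q ci).
exists s1; split; last first.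
  move=> s10; apply: sn0 => -[e I] p _ [ce cI]; apply/eqP.
  have := s1E (e, I) p (conj ce cI); rewrite (s10 (e, I)) // scaler0 => /eqP.
  rewrite scaler_eq0 => /orP[|//].
  by rewrite (negPf (proj1 (chart_O m I p) cI c)).
split=> [i k|[e I] [e' J] p _ [ce cI] [ce' cJ]].
  by rewrite setTI; apply: eq_regular_on (proj1 (gP i k)) => p _; rewrite mxE.
apply/colP => k.
pose U := chart (b := twistw E (fun c => - m c)) (e, I) `&` chart (b := twistw E (fun c => - m c)) (e', J).
have oU : zopen U by apply: zopenI; apply: zopen_chart.
have rs1 i : U `<=` chart (b := twistw E (fun c => - m c)) i ->
    forall k, regular_on U (fun q => s1 i q k 0).
  move=> Ui k'; apply: regular_onS oU Ui _.
  by apply: eq_regular_on (proj1 (gP i k')) => q _; rewrite mxE.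
apply: (@regular_on_density _ c P U (fun q => s1 (e, I) q k 0)
  (fun q => (trans (b := twistw E (fun c => - m1 c)) (e, I) (e', J) q *m s1 (e', J) q) k 0)).
- by apply: rs1 => q [].
- apply: regular_on_mulmx => // [a b|a b]; last by rewrite ord1; apply: rs1 => q [].
  exact: (@regular_trans _ _ (twistw E (fun c => - m1 c)) (e, I) (e', J) a b).
- move=> q [[ceq cIq] [ceq' cJq]] lq.
  suff -> : s1 (e, I) q = trans (b := twistw E (fun c => - m1 c)) (e, I) (e', J) q *m s1 (e', J) q by [].
  apply: (scalerI lq); rewrite -s1E // scalemxAr -s1E //= (twist_family ss ceq ceq' cIq cJq).
  have := trans_O (fun c => - m1 c) I J q.
  move=> /(congr1 (fun M : 'M_1 => M 0 0)); rewrite /= [RHS]mxE eqxx mulr1n => ->.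
  have c1 := proj1 (chart_O m I q) cIq; have c2 := proj1 (chart_O m J q) cJq.
  rewrite weightN // -scalemxAr -scalemxAl !scalerA; congr (_ *: _).
  rewrite !(weightC c) m1c m1Nc expfzDr ?coord_ratio_neq0 // expr1z.
  by rewrite /coord_ratio; field; rewrite c2.
by [].
Qed.

(** If s vanished at p, it would vanish on the fibre of [proj c] through p, and
    division by the equation of that fibre would raise the weight of the index
    in the direction c by one. *)
Lemma index_extension K (E : bundle K 2) (m m' : bool -> int) c :
  globally_generated E -> m' (~~ c) = 0 ->
  isomorphic (det_bundle E) (OQw K (fun c => m c + m' c)) ->
  is_index E (m false) (m true) -> extension (OQw K m) E (OQw K m').
Proof.
move=> gg m'0 [delta [gamma iso]] [[s [ss sn0]] max].
have delta0 I e p : chart (b := OQw K m) I p -> chart (b := E) e p -> mor delta I e p 0 0 != 0.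
  move=> cI ce; have [/(congr1 (fun M : 'M_1 => M 0 0)) + _] := iso e I p ce cI.
  rewrite mxE big_ord1 mxE eqxx => /eqP; apply: contraTneq => ->.
  by rewrite mulr0 eq_sym oner_neq0.
apply: (nowhere_zero_extension (s := s) ss delta0) => e I p ce cI.
apply/eqP => sp.
pose m1 c0 := m c0 + (c0 == c)%:R.
have : h0_neq0 (twistw E (fun c => - m1 c)).
  apply: (twist_divide (c := c) (P := proj c p) ss) => //.
  - by rewrite /m1 eqxx.
  - by rewrite /m1; case: (c); rewrite addr0.
  move=> e' J q ce' cJ qp; apply: (vanishing_on_fibre ss delta0 gg m'0 _ ce cI ce' cJ sp).
  by [].
by move=> /(max (m1 false) (m1 true)) []; rewrite /m1; case: (c); lia.
Qed.

Theorem lemma4p1 (R : realType) (E : bundle R[i] 2)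
  (gg : globally_generated E)
  (c1E : has_c1 E 2 2)
  (nsplit : ~ splits E) :
  (is_index E 0 2 -> extension (OQ R[i] 0 2) E (OQ R[i] 2 0)) /\
  (is_index E 2 0 -> extension (OQ R[i] 2 0) E (OQ R[i] 0 2)).
Proof.
pose w c a b : bool -> int := fun c0 => if c0 == c then a else b.
split=> iE.
  exact: (@index_extension _ E (w false 0 2) (w false 2 0) false).
exact: (@index_extension _ E (w true 0 2) (w true 2 0) true).
Qed.
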